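(* The only sequences of eight or more consecutive Zeckendorf-Niven terms in a $2$-AP are subsequences of $2,4,6,8,10,12,14,16,18$. That is, if a positive integer $n$ and an integer $\ell\ge 8$ are such that all of $n,n+2,n+4,\dots,n+2(\ell-1)$ are Zeckendorf-Niven, then $n,n+2,\dots,n+2(\ell-1)$ is a subsequence of $2,4,6,8,10,12,14,16,18$ (all of whose terms are Zeckendorf-Niven).
   Context: Let $F_i$ be the Fibonacci numbers: $F_0=0$, $F_1=1$, $F_i=F_{i-1}+F_{i-2}$ for $i\ge 2$. By Zeckendorf's theorem, every positive integer $n$ has a unique sequence $(\zeta_i(n))_{i=2}^\infty$ with $\zeta_i(n)\in\{0,1\}$ and $\zeta_i(n)+\zeta_{i+1}(n)\le 1$ for all $i\ge 2$, such that $n=\sum_{i=2}^\infty \zeta_i(n)F_i$ (the Zeckendorf decomposition of $n$). Put $s_Z(n)=\sum_{i=2}^\infty\zeta_i(n)$. A positive integer $n$ is called Zeckendorf-Niven if $s_Z(n)$ divides $n$. A $2$-AP is an infinite arithmetic progression of positive integers with common difference $2$. *)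

(* Defs.v *)
From mathcomp Require Import all_boot zify.

Set Implicit Arguments.
Unset Strict Implicit.
Unset Printing Implicit Defensive.

Fixpoint fib (n : nat) : nat :=
  if n is n1.+1 then (if n1 is n2.+1 then fib n1 + fib n2 else 1) else 0.
Arguments fib : simpl never.

Lemma fib0 : fib 0 = 0. Proof. by []. Qed.
Lemma fib1 : fib 1 = 1. Proof. by []. Qed.
Lemma fibSS n : fib n.+2 = fib n.+1 + fib n. Proof. by []. Qed.

(* The infinite series u_2 + u_3 + ... converges to s; in the discrete space
   nat this means that its partial sums are eventually equal to s. *)
Definition series2 (u : nat -> nat) (s : nat) : Prop :=
  exists N, forall M, N <= M -> \sum_(2 <= i < M) u i = s.

(* Digits are indexed from 2; the values z 0 and z 1 are irrelevant. *)
Definition is_zeckendorf (n : nat) (z : nat -> bool) : Prop :=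
  (forall i, 2 <= i -> z i + z i.+1 <= 1) /\
  series2 (fun i => z i * fib i) n.

Lemma fib_gt_id n : n < fib n.+2.
Proof.
suff: n < fib n.+2 /\ 0 < fib n.+1 by case.
elim: n => [//|n [IH1 IH2]]; rewrite (fibSS n.+1).
by split; lia.
Qed.

Lemma series2_unique u s t : series2 u s -> series2 u t -> s = t.
Proof.
move=> [N HN] [M HM].
by rewrite -(HN (maxn N M)) ?leq_maxl // HM ?leq_maxr.
Qed.

Lemma series2_support u N :
  (forall i, N <= i -> u i = 0) -> series2 u (\sum_(2 <= i < N) u i).
Proof.
move=> u0; exists (maxn 2 N) => M; rewrite geq_max => /andP[M2 NM].
have [N2|N2] := leqP 2 N.
  rewrite (big_cat_nat _ (n := N)) //=.
  have -> : \sum_(N <= i < M) u i = 0.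
    apply: big1_seq => i; rewrite mem_index_iota => /andP[_ /andP[Ni _]].
    exact: u0.
  exact: addn0.
rewrite [RHS]big_geq; last by lia.
rewrite big_nat_cond big1 // => i /andP[/andP[i2 _] _].
by apply: u0; lia.
Qed.

Lemma zeckendorf_partial_lt (z : nat -> bool) M :
  (forall i, 2 <= i -> z i + z i.+1 <= 1) ->
  \sum_(2 <= i < M.+1) z i * fib i < fib M.+1.
Proof.
move=> zz.
suff: \sum_(2 <= i < M.+1) z i * fib i < fib M.+1 /\
      \sum_(2 <= i < M.+2) z i * fib i < fib M.+2 by case.
elim: M => [|M [IH1 IH2]]; first by rewrite !big_geq.
split=> //; rewrite big_nat_recr //=.
case zM: (z M.+2); last by rewrite (fibSS M.+1); lia.
rewrite mul1n (fibSS M.+1) addnC ltn_add2l.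
case: M zM IH1 {IH2} => [|M] zM IH1; first by rewrite big_geq.
have := zz M.+2 isT; rewrite zM addn1 ltnS leqn0 eqb0 => /negbTE z0.
by rewrite big_nat_recr //= z0 mul0n addn0.
Qed.

Lemma zeckendorf_exists n : {z : nat -> bool | is_zeckendorf n z}.
Proof.
suff H k : forall m, m < fib k -> {z : nat -> bool |
    [/\ forall i, 2 <= i -> z i + z i.+1 <= 1,
        forall i, k <= i -> z i = false &
        \sum_(2 <= i < k) z i * fib i = m]}.
  have [z [z1 z2 z3]] := H _ _ (fib_gt_id n).
  exists z; split=> //; rewrite -z3.
  by apply: (@series2_support (fun i => z i * fib i)) => i /z2 ->.
suff: (forall m, m < fib k -> {z : nat -> bool |
    [/\ forall i, 2 <= i -> z i + z i.+1 <= 1,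
        forall i, k <= i -> z i = false &
        \sum_(2 <= i < k) z i * fib i = m]}) *
  (forall m, m < fib k.+1 -> {z : nat -> bool |
    [/\ forall i, 2 <= i -> z i + z i.+1 <= 1,
        forall i, k < i -> z i = false &
        \sum_(2 <= i < k.+1) z i * fib i = m]}) by case.
elim: k => [|k [IH1 IH2]].
  split=> [//|m]; case: m => // _; exists (fun=> false); split=> //.
  by rewrite big_geq.
split=> // m mk; have [mk1|mk1] := ltnP m (fib k.+1).
  have [z [z1 z2 z3]] := IH2 m mk1.
  exists z; split=> // [i ki|]; first by apply: z2; lia.
  case: k {IH1 IH2 mk mk1} z1 z2 z3 => [|k] z1 z2 z3.
    by move: z3; rewrite !big_geq.
  by rewrite big_nat_recr //= z2 // mul0n addn0.
case: k IH1 IH2 mk mk1 => [|k] IH1 IH2 mk mk1.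
  by exfalso; move: mk mk1; rewrite fibSS fib1 fib0; lia.
rewrite fibSS in mk.
have /IH1[z [z1 z2 z3]] : m - fib k.+2 < fib k.+1 by lia.
exists (fun i => (i == k.+2) || z i); split.
- move=> i i2; have := z1 i i2.
  have [->|ne1] := eqVneq i k.+2.
    by rewrite gtn_eqF // !z2 //; lia.
  have [e|//] := eqVneq i.+1 k.+2.
  by rewrite /= z2 //; lia.
- by move=> i ki; rewrite gtn_eqF //= z2 //; lia.
- rewrite big_nat_recr //= eqxx mul1n.
  suff -> : \sum_(2 <= i < k.+2) ((i == k.+2) || z i) * fib i = m - fib k.+2.
    by lia.
  rewrite -z3; case: k {IH1 IH2 mk mk1 z1 z3} z2 => [|k] z2.
    by rewrite !big_geq.
  rewrite big_nat_recr //= z2 // orbF ltn_eqF // addn0.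
  by apply: eq_big_nat => i /andP[_ ik]; rewrite ltn_eqF //; lia.
Qed.

Lemma zeckendorf_unique n (z w : nat -> bool) :
  is_zeckendorf n z -> is_zeckendorf n w -> forall i, 2 <= i -> z i = w i.
Proof.
move=> [zz [N HN]] [ww [M HM]] i i2.
suff H K : \sum_(2 <= j < K.+2) z j * fib j = \sum_(2 <= j < K.+2) w j * fib j ->
    forall j, 2 <= j < K.+2 -> z j = w j.
  apply: (H (N + M + i)); last by lia.
  by rewrite HN ?HM //; lia.
elim: K => [|K IH]; first by move=> _ j; lia.
rewrite !(@big_nat_recr _ _ _ K.+2) //= => E j.
have lz := @zeckendorf_partial_lt z K.+1 zz.
have lw := @zeckendorf_partial_lt w K.+1 ww.
have e : z K.+2 = w K.+2.
  case: (z K.+2) (w K.+2) E => [] [] //; rewrite mul0n mul1n; lia.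
rewrite e in E; move/addIn: E => /IH E.
have [-> //|ne] := eqVneq j K.+2.
by move=> hj; apply: E; lia.
Qed.

(* The Zeckendorf digits zeta_i(n); by zeckendorf_unique they are determined
   by zetaP for i >= 2. *)
Definition zeta (n : nat) : nat -> bool := sval (zeckendorf_exists n).

Lemma zetaP n : is_zeckendorf n (zeta n).
Proof. exact: svalP (zeckendorf_exists n). Qed.

(* The digit sum stops at i = n + 1 because fib i > n for i >= n + 2;
   sZP shows that it is the sum of the whole series. *)
Definition sZ (n : nat) : nat := \sum_(2 <= i < n.+2) zeta n i.

Lemma zeta_support n i : n.+2 <= i -> zeta n i = false.
Proof.
move=> ni; apply/negbTE/negP => zi; have [_ [N HN]] := zetaP n.
have := HN (maxn N i.+1) (leq_maxl _ _).
rewrite (big_cat_nat _ (n := i.+1)) ?leq_maxr //=; last by lia.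
rewrite big_nat_recr /=; last by lia.
rewrite zi mul1n.
have := fib_gt_id i.-2.
have -> : i.-2.+2 = i by lia.
lia.
Qed.

Lemma sZP n : series2 (fun i => zeta n i) (sZ n).
Proof.
by apply: (@series2_support (fun i => zeta n i)) => i /zeta_support ->.
Qed.

Definition zeckendorf_niven (n : nat) : bool := (0 < n) && (sZ n %| n).

(* Main.v *)
(* Fix k = 11 and split n = h + r, where r collects the Zeckendorf digits of
   index below k.  On the block h, ..., h + L - 1 (L = F_k or F_{k-1}) the high
   digits are constant, so s_Z(h + x) = s + s_Z(x), and h + L starts the next
   block.  A window n, n + 2, ..., n + 14 meets at most two blocks.  If h > 0,
   in one of them two terms of the window have equal digit sums, which must
   divide their difference (at most 14) and so leaves finitely many s; each of
   these is excluded by two terms h + x, h + y for which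
   gcd(s + s_Z(x), s + s_Z(y)) does not divide y - x.  With a smaller k
   one boundary window survives this test.  If h = 0 then n < 89, and
   n = 2, 4 are the only solutions. *)
Require Import Defs.
From mathcomp Require Import all_boot zify.

Set Implicit Arguments.
Unset Strict Implicit.
Unset Printing Implicit Defensive.

(** * Digits and digit sums as finite sums *)

Lemma fib_leq i j : i <= j -> fib i <= fib j.
Proof.
move=> ij; rewrite -(subnK ij); elim: (j - i) => // d IH.
apply: leq_trans IH _; rewrite addSn.
by case: (d + i) => [|e]; rewrite ?fibSS ?leq_addr.
Qed.

Lemma zeta_adjacent n i : 2 <= i -> zeta n i -> zeta n i.+1 = false.
Proof. by have [zz _] := zetaP n => /zz; case: (zeta n i); case: (zeta n i.+1). Qed.

Lemma zeta_sum_support (z : nat -> bool) K :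
  (forall i, 2 <= i -> z i + z i.+1 <= 1) -> (forall i, K <= i -> z i = false) ->
  forall i, 2 <= i -> zeta (\sum_(2 <= i < K) z i * fib i) i = z i.
Proof.
move=> zz z0; apply: zeckendorf_unique (zetaP _) _; split=> //.
by apply: (@series2_support (fun i => z i * fib i)) => i /z0 ->.
Qed.

Lemma zeta_sum n K : n.+2 <= K -> \sum_(2 <= i < K) zeta n i * fib i = n.
Proof.
move=> nK; apply: series2_unique (proj2 (zetaP n)).
apply: (@series2_support (fun i => zeta n i * fib i)) => i Ki.
by rewrite zeta_support // (leq_trans nK).
Qed.

Lemma sZ_sum n K : n.+2 <= K -> \sum_(2 <= i < K) zeta n i = sZ n.
Proof.
move=> nK; apply: series2_unique (sZP n).
apply: (@series2_support (fun i => zeta n i)) => i Ki.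
by rewrite zeta_support // (leq_trans nK).
Qed.

Lemma sZ_gt0 n : 0 < n -> 0 < sZ n.
Proof.
rewrite !lt0n; apply: contra_neq => /eqP; rewrite sum_nat_seq_eq0 => /allP z0.
rewrite -(@zeta_sum n n.+2) // big1_seq // => i /andP[_ /z0].
by rewrite implyTb => /eqP ->.
Qed.

Lemma zeta_lt_fib n i : 2 <= i -> n < fib i -> zeta n i = false.
Proof.
move=> i2 ni; apply/negP => zi.
have := @zeta_sum n (maxn n.+2 i.+1) (leq_maxl _ _).
rewrite (@big_cat_nat _ _ _ i.+1) ?leq_maxr //=; last by lia.
by rewrite big_nat_recr //= zi mul1n; lia.
Qed.

(** * Blocks of integers with common high digits *)

Definition zlow k n := \sum_(2 <= i < k) zeta n i * fib i.
(** The upper bound is at least both [n.+2], beyond which all digits of [n] vanish, and [k], so that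
    the range can be appended to that of [zlow]. *)
Definition zhigh k n := \sum_(k <= i < n.+2 + k) zeta n i * fib i.
Definition shigh k n := \sum_(k <= i < n.+2 + k) nat_of_bool (zeta n i).
(** The block length: a digit 1 at index [k] forces a 0 at [k.-1], which leaves [fib k.-1] low parts
    instead of [fib k]. *)
Definition zlen k n := if zeta n k then fib k.-1 else fib k.

Lemma zhighDzlow k n : 2 <= k -> zhigh k n + zlow k n = n.
Proof.
move=> k2; rewrite addnC /zlow /zhigh -big_cat_nat ?leq_addl //=.
by apply: zeta_sum; lia.
Qed.

Lemma zlow_lt_fib k n : 2 <= k -> zlow k n < fib k.
Proof.
case: k => // k k2; apply: zeckendorf_partial_lt.
by have [] := zetaP n.
Qed.

Lemma zlow_lt k n : 2 <= k -> zlow k n < zlen k n.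
Proof.
case: k => [|k] // k2; rewrite /zlen; case: ifP => zk; last exact: zlow_lt_fib.
have [-> |k1] := eqVneq k 1; first by rewrite /zlow big_geq.
have k2' : 2 <= k by lia.
rewrite /zlow big_nat_recr //=.
have -> : zeta n k = false.
  by apply/negP => /(@zeta_adjacent _ _ k2'); rewrite zk.
by rewrite addn0 zlow_lt_fib.
Qed.

Lemma zlen_leq_fib k n : zlen k n <= fib k.
Proof. by rewrite /zlen; case: ifP => // _; apply/fib_leq/leq_pred. Qed.

(** Glue the digits of [r] below [k] to those of [n] from [k] on. Two adjacent ones could only arise
    at [k.-1] and [k], and [r < zlen k n] excludes this; uniqueness of the decomposition does the
    rest. *)
Lemma zeta_block k n r i : 2 <= k -> r < zlen k n -> 2 <= i ->
  zeta (zhigh k n + r) i = if i < k then zeta r i else zeta n i.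
Proof.
case: k => [|k] // k2 rL i2.
have rk : r < fib k.+1 by apply: leq_trans rL (zlen_leq_fib _ _).
have r0 j : k < j -> zeta r j = false.
  move=> kj; apply: zeta_lt_fib; first by lia.
  by apply: leq_trans rk _; apply: fib_leq.
pose z j := if j < k.+1 then zeta r j else zeta n j.
(* Any bound past the supports of both digit sequences would do. *)
pose K := r.+2 + (n.+2 + k.+1).
suff -> : zhigh k.+1 n + r = \sum_(2 <= j < K) z j * fib j.
  rewrite zeta_sum_support // => [j j2|j Kj]; last first.
    by rewrite /z ifF ?zeta_support //; rewrite /K in Kj; lia.
  rewrite /z !ltnS.
  have [jk|jk|jk] := ltngtP j k; first by have [+ _] := zetaP r; apply.
    by have [+ _] := zetaP n; apply.
  rewrite jk in j2 *; move: rL; rewrite /zlen.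
  case: (zeta n k.+1) => [rk'|_]; last by case: (zeta r k).
  by rewrite zeta_lt_fib.
rewrite (@big_cat_nat _ _ _ k.+1) /=; [|by lia|by rewrite /K; lia].
rewrite addnC; congr (_ + _).
  rewrite -[LHS](@zeta_sum r (k.+1 + r.+2)); last by lia.
  rewrite (@big_cat_nat _ _ _ k.+1) /=; [|by lia|by lia].
  rewrite [X in _ + X]big1_seq ?addn0; last first.
    by move=> j; rewrite mem_index_iota => /and3P[_ kj _]; rewrite r0.
  by apply: eq_big_nat => j /andP[_ jk]; rewrite /z jk.
rewrite [RHS](@big_cat_nat _ _ _ (n.+2 + k.+1)) /=; [|by lia|by rewrite /K; lia].
rewrite [X in _ + X]big1_seq ?addn0; last first.
  move=> j; rewrite mem_index_iota => /and3P[_ kj _].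
  by rewrite /z ifF ?zeta_support; lia.
by apply: eq_big_nat => j /andP[kj _]; rewrite /z ltnNge kj.
Qed.

Lemma zlow_block k n r : 2 <= k -> r < zlen k n -> zlow k (zhigh k n + r) = r.
Proof.
move=> k2 rL; rewrite -[RHS](@zeta_sum r (k + r.+2)); last by lia.
rewrite [RHS](@big_cat_nat _ _ _ k) /=; [|by lia|by lia].
rewrite [X in _ = _ + X]big1_seq ?addn0.
  by apply: eq_big_nat => i /andP[i2 ik]; rewrite zeta_block // ik.
move=> i; rewrite mem_index_iota => /and3P[_ ki _].
rewrite zeta_lt_fib //; first by lia.
apply: leq_trans rL _; apply: leq_trans (zlen_leq_fib _ _) _.
exact: fib_leq.
Qed.

Lemma sZ_block k n r : 2 <= k -> r < zlen k n ->
  sZ (zhigh k n + r) = shigh k n + sZ r.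
Proof.
move=> k2 rL; have rk := leq_trans rL (zlen_leq_fib _ _).
have hn : zhigh k n <= n by rewrite -{2}(@zhighDzlow k n) ?leq_addr //; lia.
rewrite -(@sZ_sum _ (r.+2 + (n.+2 + k))); last by lia.
rewrite (@big_cat_nat _ _ _ k) /=; [|by lia|by lia].
rewrite addnC; congr (_ + _).
  rewrite (@big_cat_nat _ _ _ (n.+2 + k)) /=; [|by lia|by lia].
  rewrite [X in _ + X]big1_seq ?addn0.
    apply: eq_big_nat => i /andP[ki _].
    by rewrite zeta_block // ?(ltnNge i) ?ki //; lia.
  move=> i; rewrite mem_index_iota => /and3P[_ ki _].
  by rewrite zeta_block ?ifF ?zeta_support //; lia.
rewrite -(@sZ_sum r (k + r.+2)); last by lia.
rewrite [RHS](@big_cat_nat _ _ _ k) /=; [|by lia|by lia].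
rewrite [X in _ = _ + X]big1_seq ?addn0.
  by apply: eq_big_nat => i /andP[i2 ik]; rewrite zeta_block // ik.
move=> i; rewrite mem_index_iota => /and3P[_ ki _].
rewrite zeta_lt_fib //; first by lia.
by apply: leq_trans rk _; apply: fib_leq.
Qed.

Lemma zlen_gt0 k n : 2 <= k -> 0 < zlen k n.
Proof. by move=> k2; apply: leq_ltn_trans (zlow_lt n k2). Qed.

(** Otherwise the number [m] after the block of [n] and its predecessor, the last element of that
    block, share a block. Then [m] and [n] have the same digit at [k], hence the same block length,
    and the low part of [m] would equal that length. *)
Lemma zlow_next k n : 2 <= k -> zlow k (zhigh k n + zlen k n) = 0.
Proof.
move=> k2; set m := _ + _; apply/eqP; rewrite -leqn0 leqNgt; apply/negP => lm.
have Ln := zlen_gt0 n k2; have lL := zlow_lt m k2.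
have e : zhigh k m + (zlow k m).-1 = zhigh k n + (zlen k n).-1.
  by have := zhighDzlow m k2; rewrite {3}/m; lia.
clearbody m; have := congr1 (zlow k) e; rewrite !zlow_block //; [|lia|lia] => el.
have := congr1 (fun x => zeta x k) e.
rewrite /= !zeta_block ?ltnn //; [|lia|lia] => ez.
have : zlen k m = zlen k n by rewrite /zlen ez.
lia.
Qed.

(** * Computing digit sums by the greedy algorithm *)

Lemma zeta_fib k i : 2 <= k -> 2 <= i -> zeta (fib k) i = (i == k).
Proof.
move=> k2 i2.
have -> : fib k = \sum_(2 <= j < k.+1) (j == k) * fib j.
  rewrite big_nat_recr //= eqxx mul1n big_nat_cond big1 // => j /andP[/andP[_ jk] _].
  by rewrite ltn_eqF.
rewrite (@zeta_sum_support (fun j => j == k)) // => j.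
  by case: (eqVneq j k) => [->|_] _; [rewrite gtn_eqF|case: (_ == _)].
by move=> kj; rewrite gtn_eqF.
Qed.

Lemma sZ0 : sZ 0 = 0.
Proof. by rewrite /sZ big_geq. Qed.

Lemma sZ_fibD k r : 2 <= k -> r < fib k.-1 -> sZ (fib k + r) = (sZ r).+1.
Proof.
move=> k2 rk.
have hk : zhigh k (fib k) = fib k.
  rewrite -[RHS](zhighDzlow (fib k) k2) /zlow big1_seq ?addn0 // => i.
  by rewrite mem_index_iota => /and3P[_ i2 ik]; rewrite zeta_fib // ltn_eqF.
have L : zlen k (fib k) = fib k.-1 by rewrite /zlen zeta_fib ?eqxx.
rewrite -{1}hk sZ_block ?L // -[RHS]add1n; congr (_ + _).
rewrite /shigh big_ltn ?zeta_fib ?eqxx //; last by lia.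
rewrite big1_seq // => i; rewrite mem_index_iota => /and3P[_ ki _].
by rewrite zeta_fib ?gtn_eqF //; lia.
Qed.

(** An evaluable form of [sZ], whose digits come from an opaque existence proof. For [m < fib k.+1]
    nothing is left at index 1, so [fib 1 = fib 2] causes no double count. *)
Fixpoint greedy k m :=
  if k is k'.+1 then
    if fib k <= m then (greedy k' (m - fib k)).+1 else greedy k' m
  else 0.

Lemma sZ_greedy k m : 0 < k -> m < fib k.+1 -> sZ m = greedy k m.
Proof.
elim: k m => // -[|k] IH m _ mk.
  have -> : m = 0 by move: mk; rewrite fibSS fib1 fib0; lia.
  by rewrite sZ0.
rewrite [RHS]/=; case: leqP => km; last exact: IH.
have rk : m - fib k.+2 < fib k.+1 by rewrite fibSS in mk; lia.
rewrite -{1}(subnKC km) sZ_fibD // IH //.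
by apply: leq_trans rk _; apply: fib_leq.
Qed.

(** * Finite test on the offsets of a window *)

(** The first clause forces an unknown high digit sum [s] to be at most 14, the second refutes each
    [s] from 1 to 14. Index 10 suffices for offsets below [fib 11]. *)
Definition obstructed (l : seq nat) : bool :=
  let c := greedy 10 in
  has (fun x => has (fun y => [&& x < y, y - x <= 14 & c x == c y]) l) l &&
  all (fun s => has (fun x => has (fun y =>
         ~~ (gcdn (s + c x) (s + c y) %| y - x)) l) l) (iota 1 14).

Lemma obstructedP (h s : nat) (l : seq nat) : 0 < s -> obstructed l ->
  (forall x, x \in l -> sZ (h + x) = s + greedy 10 x) ->
  (forall x, x \in l -> zeckendorf_niven (h + x)) -> False.
Proof.
move=> s0 /andP[/hasP[x xl /hasP[y yl /and3P[xy d14 /eqP cxy]]] /allP ob] hs hN.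
have dv z : z \in l -> s + greedy 10 z %| h + z.
  by move=> zl; rewrite -hs //; have /andP[] := hN z zl.
have sub a b d z : d %| a -> d %| b -> b - a = z -> d %| z.
  by move=> da db <-; apply: dvdn_sub.
have sd : s + greedy 10 x %| y - x.
  by apply: (sub _ _ _ _ (dv x xl)); [rewrite cxy; exact: dv y yl | lia].
have /ob/hasP[a al /hasP[b bl /negP[]]] : s \in iota 1 14.
  by rewrite mem_iota; have := dvdn_leq _ sd; lia.
apply: (sub (h + a) (h + b)); last lia.
  exact: dvdn_trans (dvdn_gcdl _ _) (dv a al).
exact: dvdn_trans (dvdn_gcdr _ _) (dv b bl).
Qed.

(** Offsets are relative to the start of the block containing them, hence the shift by [L] in
    [window_after]. *)
Definition window_before L r := [seq x <- [seq r + 2 * j | j <- iota 0 8] | x < L].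
Definition window_after L r :=
  [seq x - L | x <- [seq r + 2 * j | j <- iota 0 8] & L <= x].

Lemma windows_obstructed L r : (L == fib 10) || (L == fib 11) -> r < L ->
  obstructed (window_before L r) || obstructed (window_after L r).
Proof.
move=> hL rL.
have : all (fun L => all (fun r =>
    obstructed (window_before L r) || obstructed (window_after L r)) (iota 0 L))
    [:: fib 10; fib 11] by vm_compute.
move=> /allP/(_ L); rewrite !inE => /(_ hL)/allP/(_ r); apply.
by rewrite mem_iota.
Qed.

Lemma small_windows n : 0 < n < 89 -> n \notin [:: 2; 4] ->
  exists2 j, j < 8 & ~~ zeckendorf_niven (n + 2 * j).
Proof.
move=> n_in n24.
have : all (fun n => (n \in [:: 2; 4]) ||
    has (fun j => ~~ (greedy 11 (n + 2 * j) %| n + 2 * j)) (iota 0 8)) (iota 1 88).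
  by vm_compute.
move=> /allP/(_ n); rewrite mem_iota (negbTE n24) => /(_ _)/hasP[|j]; first by lia.
rewrite mem_iota => j8 ndv; exists j => //.
rewrite /zeckendorf_niven (@sZ_greedy 11) ?(negbTE ndv) ?andbF //.
have -> : fib 12 = 144 by vm_compute.
lia.
Qed.

(** * Possible first terms and the conclusion *)

Lemma eight_terms n : 0 < n ->
  (forall j, j < 8 -> zeckendorf_niven (n + 2 * j)) -> n \in [:: 2; 4].
Proof.
move=> n0 hN; apply/negPn/negP => n24.
have [n89|n89] := ltnP n 89.
  have [|j j8 /negP[]] := @small_windows n _ n24; first by rewrite n0.
  exact: hN.
have k2 : 2 <= 11 by [].
have f11 : fib 11 = 89 by vm_compute.
have f10 : fib 10 = 55 by vm_compute.
have rL := zlow_lt n k2; have en := zhighDzlow n k2.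
have LL := zlen_leq_fib 11 n.
have hL : (zlen 11 n == fib 10) || (zlen 11 n == fib 11).
  by rewrite /zlen; case: ifP; rewrite eqxx ?orbT.
have L55 : 55 <= zlen 11 n by case/orP: hL => /eqP ->; lia.
have sh_gt0 m : 0 < zhigh 11 m -> 0 < shigh 11 m.
  move=> /sZ_gt0; rewrite -[zhigh 11 m]addn0 sZ_block ?zlen_gt0 //.
  by rewrite sZ0 addn0.
have sum_block m x : x < zlen 11 m ->
    sZ (zhigh 11 m + x) = shigh 11 m + greedy 10 x.
  move=> xL; rewrite sZ_block // (@sZ_greedy 10) //.
  exact: leq_trans xL (zlen_leq_fib _ _).
have term x : x \in [seq zlow 11 n + 2 * j | j <- iota 0 8] ->
    zeckendorf_niven (zhigh 11 n + x) /\ x <= zlow 11 n + 14.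
  move=> /mapP[j]; rewrite mem_iota => j8 ->.
  by rewrite addnA en; split; [apply: hN | lia].
have /orP[ob|ob] := windows_obstructed hL rL.
  apply: (@obstructedP (zhigh 11 n) (shigh 11 n) _ _ ob) => [|x|x].
  (* The high part is positive because the low part is below 89, which is at most [n]. *)
  - by apply: sh_gt0; lia.
  - by rewrite mem_filter => /andP[xL _]; apply: sum_block.
  - by rewrite mem_filter => /andP[_ /term[]].
pose m := zhigh 11 n + zlen 11 n.
have em : zhigh 11 m = m.
  by rewrite -[RHS](zhighDzlow m k2) /m zlow_next // addn0.
(* Offsets into the next block are below 14, so the window never reaches a third block. *)
have L55' : 55 <= zlen 11 m by rewrite /zlen; case: ifP => _; rewrite ?f10 ?f11.
apply: (@obstructedP m (shigh 11 m) _ _ ob) => [|x|x].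
- by apply: sh_gt0; rewrite em /m; lia.
- move=> /mapP[y]; rewrite mem_filter => /andP[_ /term[_ yb]] ->.
  by rewrite -{1}em sum_block //; lia.
- move=> /mapP[y]; rewrite mem_filter => /andP[Ly /term[ny _]] ->.
  by rewrite /m -addnA subnKC.
Qed.

Theorem theorem4p3 :
  (forall n l : nat, 0 < n -> 8 <= l ->
     (forall k : nat, k < l -> zeckendorf_niven (n + 2 * k)) ->
     subseq [seq n + 2 * k | k <- iota 0 l]
            [:: 2; 4; 6; 8; 10; 12; 14; 16; 18]) /\
  (forall m : nat, m \in [:: 2; 4; 6; 8; 10; 12; 14; 16; 18] ->
     zeckendorf_niven m).
Proof.
split=> [n l n0 l8 hN|m hm].
  have n24 := eight_terms n0 (fun j j8 => hN j (leq_trans j8 l8)).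
  (* Since 20 = 13 + 5 + 2 has digit sum 3, a progression starting at 2 or 4 must stop by 18. *)
  have n20 : ~~ zeckendorf_niven 20.
    by rewrite /zeckendorf_niven (@sZ_greedy 11).
  have l20 : n + 2 * l <= 20.
    rewrite leqNgt; apply/negP => l20; move/negP: n20; apply.
    have -> : 20 = n + 2 * (20 - n)./2.
      by move: n24; rewrite !inE => /orP[] /eqP ->.
    by apply: hN; move: n24 l20; rewrite !inE => /orP[] /eqP ->; lia.
  have l_in : l \in [:: 8; 9] by move: n24; rewrite !inE; lia.
  by move: n24 l_in l20; rewrite !inE => /orP[] /eqP -> /orP[] /eqP ->.
have : all (fun m => [&& 0 < m, m < fib 12 & greedy 11 m %| m])
    [:: 2; 4; 6; 8; 10; 12; 14; 16; 18] by vm_compute.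
move=> /allP/(_ m hm)/and3P[m0 mf dv].
by rewrite /zeckendorf_niven m0 (@sZ_greedy 11).
Qed.
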